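(* There is an absolute constant $C$ such that for every real $\varepsilon$ with $0<\varepsilon<1$ there is a positive integer $n_0=n_0(\varepsilon)$ such that for all integers $n\ge n_0$ there exist $C$-log-sparse sets $S_1,\dots,S_n\subset\mathbb{Z}_{>0}$ for which the sumset $S=S_1+S_2+\cdots+S_n$ contains an arithmetic progression of length at least $n^{(1-\varepsilon)^2 n}$.
   Context: A subset $A\subset\mathbb{Z}_{>0}$ is $C$-log-sparse if $|A\cap[x,2x)|\le C$ for every positive integer $x$. The constant $C$ here is absolute: it depends on neither $\varepsilon$ nor $n$. The sumset $S_1+\cdots+S_n$ of sets $S_1,\dots,S_n\subset\mathbb{Z}_{>0}$ is the set of all positive integers of the form $x_1+\cdots+x_n$ with $x_i\in S_i$ for every $i$. An arithmetic progression of length $k$ is a set $\{a,a+d,\dots,a+(k-1)d\}$ with $a$ and $d\ge 1$ integers. *)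

(* Defs.v *)
From HB Require Import structures.
From mathcomp Require Import all_boot all_order all_algebra.
From mathcomp Require Import boolp classical_sets functions cardinality.

Set Implicit Arguments.
Unset Strict Implicit.
Unset Printing Implicit Defensive.

Local Open Scope classical_set_scope.
Local Open Scope card_scope.
Local Open Scope nat_scope.

(* Subsets of Z_{>0} are sets of natural numbers that omit 0. *)
Definition positive_set (A : set nat) : Prop := A `<=` [set x | 0 < x].

Definition log_sparse (C : nat) (A : set nat) : Prop :=
  forall x : nat, 0 < x -> A `&` [set y | x <= y < 2 * x] #<= `I_C.

Definition sumset (n : nat) (S : 'I_n -> set nat) : set nat :=
  [set \sum_(i < n) x i | x in [set x : 'I_n -> nat | forall i, S i (x i)]].

Definition arith_prog (a d k : nat) : set nat := [set a + i * d | i in `I_k].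

(* Main.v *)
Require Import Defs.
From HB Require Import structures.
From mathcomp Require Import all_boot all_order all_algebra.
From mathcomp Require Import boolp classical_sets functions cardinality reals exp.
From mathcomp Require Import zify lra.

Set Implicit Arguments.
Unset Strict Implicit.
Unset Printing Implicit Defensive.

Import Order.TTheory GRing.Theory Num.Theory.
Local Open Scope classical_set_scope.
Local Open Scope ring_scope.

(** The sets are [S_i = {M * 2 ^ e + c_i * e : e >= 0}], where [c_i = b ^ i] for
    [i < J], where [c_i = 0] for the other [K = n - J] indices, and where
    [M = b ^ J].  The term [M * 2 ^ e] dominates, so it makes the set
    log-sparse; the small term [c_i * e] carries the information.

    Take [t < b ^ J], and let the first [J] exponents be the base-[b] digits of
    [t].  The small terms then add up to exactly [t], and the dominant terms to
    [M * u], where [u] is the sum of the [2 ^ d] over the digits [d] of [t].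
    This unwanted [u] depends on [t], but it is at most [J * 2 ^ b], which is
    tiny compared with [b ^ J].  So few of the remaining sets suffice to
    compensate for it: [K] powers of two, chosen freely, can add up to any
    integer from [2 ^ K - 1] to [2 ^ K.+1 - 2] ([sum_pow2_range]), in particular
    to [2 ^ K.+1 - 2 - u] as soon as [u < 2 ^ K].  The whole sum is then
    [M * (2 ^ K.+1 - 2) + t], a fixed translate of [t]
    ([interval_in_sumset]), so the sumset contains [b ^ J] consecutive integers.

    The parameters are [b] close to [n ^ (1 - eps)] and [J] close to
    [(1 - eps) * n], whence the length [b ^ J >= n ^ ((1 - eps) ^ 2 * n)].  The
    requirement [J * 2 ^ b < 2 ^ (n - J)] holds for large [n] because
    [b + log2 n = O(n ^ (1 - eps))] is eventually below [eps * n]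
    ([parameters]). *)

(** * Perturbed powers of two *)

Definition perturbed_pow2 (M c e : nat) : nat := (M * 2 ^ e + c * e)%N.

Lemma perturbed_pow2_ge (M c e : nat) : (M * 2 ^ e <= perturbed_pow2 M c e)%N.
Proof. exact: leq_addr. Qed.

Lemma perturbed_pow2_lt (M c e : nat) : (0 < M)%N -> (c <= M)%N ->
  (perturbed_pow2 M c e < M * 2 ^ e.+1)%N.
Proof.
move=> M0 cM; rewrite /perturbed_pow2 expnS mulnCA mul2n -addnn ltn_add2l.
apply: (@leq_ltn_trans (M * e)%N); first by rewrite leq_mul2r cM orbT.
by rewrite ltn_pmul2l// ltn_expl.
Qed.

Lemma positive_perturbed_pow2 (M c : nat) : (0 < M)%N ->
  positive_set (range (perturbed_pow2 M c)).
Proof.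
move=> M0 _ [e _ <-] /=; apply: leq_trans (perturbed_pow2_ge M c e).
by rewrite muln_gt0 M0 expn_gt0.
Qed.

(** The element of exponent [e] is at least [M * 2 ^ e] and less than [M * 2 ^ e.+1],
    and a window from [x] to [2 * x] meets at most two of these consecutive dyadic intervals. *)
Lemma log_sparse_perturbed_pow2 (M c : nat) : (0 < M)%N -> (c <= M)%N ->
  log_sparse 2 (range (perturbed_pow2 M c)).
Proof.
move=> M0 cM x x0.
have exP : exists e, (x < M * 2 ^ e.+1)%N.
  exists x; apply: (@leq_trans (2 ^ x.+1)%N); last by rewrite leq_pmull.
  by rewrite (ltn_trans (ltnSn x))// ltn_expl.
case: (ex_minnP exP) => e0 xe0 min_e0.
apply: card_le_trans (card_image_le (fun i => perturbed_pow2 M c (e0 + i)) _).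
apply: subset_card_le => _ [[e _ <-] /= /andP[lex ltx]].
have le0 : (e0 <= e)%N.
  by apply: min_e0; apply: leq_ltn_trans lex _; exact: perturbed_pow2_lt.
exists (e - e0)%N; last by rewrite subnKC.
rewrite /= ltnNge; apply/negP => e2.
have : (M * 2 ^ e0.+2 <= M * 2 ^ e)%N.
  by rewrite leq_pmul2l// leq_exp2l//; lia.
have := perturbed_pow2_ge M c e.
rewrite [(2 ^ e0.+2)%N]expnS mulnCA; lia.
Qed.

(** * Digits and compensation *)

Lemma base_digits (b J t : nat) : (0 < b)%N -> (t < b ^ J)%N ->
  exists d : nat -> nat,
    (forall j, d j < b)%N /\ (\sum_(j < J) b ^ j * d j)%N = t.
Proof.
move=> b0; elim: J t => [|J IH] t tJ.
  by exists (fun=> 0%N); rewrite big_ord0; split => //; rewrite expn0 in tJ; lia.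
have [|d [db dt]] := IH (t %/ b)%N; first by rewrite ltn_divLR// -expnSr.
exists (fun j => if j is j'.+1 then d j' else (t %% b)%N); split.
  by case=> [|j] //; rewrite ltn_mod.
rewrite big_ord_recl /= mul1n [RHS](divn_eq t b) addnC -dt big_distrl /=.
by congr addn; apply: eq_bigr => j _; rewrite expnS -mulnA mulnC.
Qed.

(** Induction on [K]: use [2 ^ 0] or [2 ^ 1] once, according to the parity of
    [N], and double the representation of half of the remainder. *)
Lemma sum_pow2_range (K N : nat) :
  (2 ^ K <= N.+1)%N -> (N.+1 < 2 ^ K.+1)%N ->
  exists e : nat -> nat, (\sum_(k < K) 2 ^ e k)%N = N.
Proof.
elim: K N => [|K IH] N.
  by move=> _ N1; exists (fun=> 0%N); rewrite big_ord0; lia.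
move=> lN uN; pose p := nat_of_bool (~~ odd N).
have hN : N = (2 ^ p + 2 * (N.-1)./2)%N.
  rewrite /p; case: (boolP (odd N)) => oN /=; rewrite ?expn0 ?expn1; first lia.
  by move: lN; rewrite expnS; have := expn_gt0 2 K; lia.
have p12 : (2 ^ p = 1)%N \/ (2 ^ p = 2)%N by rewrite /p; case: odd; [left|right].
move: lN uN; rewrite !expnS => lN uN.
have [||e eN] := IH (N.-1)./2; [lia|rewrite expnS; lia|].
exists (fun k => if k is k'.+1 then (e k').+1 else p).
rewrite big_ord_recl /= [RHS]hN -eN big_distrr /=.
by congr addn; apply: eq_bigr => k _; rewrite expnS.
Qed.

Lemma interval_in_sumset (b J K : nat) : (0 < b)%N -> (J * 2 ^ b < 2 ^ K)%N ->
  exists S : 'I_(J + K) -> set nat,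
    (forall i, positive_set (S i) /\ log_sparse 2 (S i)) /\
    exists a, arith_prog a 1 (b ^ J) `<=` sumset S.
Proof.
move=> b0 JK; pose M := (b ^ J)%N.
pose c (i : nat) := (if i < J then b ^ i else 0)%N.
have M0 : (0 < M)%N by rewrite expn_gt0 b0.
have cM i : (c i <= M)%N.
  by rewrite /c; case: ifP => // iJ; rewrite leq_pexp2l// ltnW.
exists (fun i => range (perturbed_pow2 M (c i))); split=> [i|].
  by split; [exact: positive_perturbed_pow2|exact: log_sparse_perturbed_pow2].
exists (M * (2 ^ K.+1).-2)%N => _ [t /= tM <-]; rewrite muln1.
have [d [db dt]] := base_digits b0 tM.
pose u := (\sum_(j < J) 2 ^ d j)%N.
have uK : (u < 2 ^ K)%N.
  apply: leq_ltn_trans JK; rewrite -[X in (_ <= X * _)%N]card_ord -sum_nat_const.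
  by apply: leq_sum => j _; rewrite leq_pexp2l// ltnW.
have K2 : (2 ^ K.+1 = 2 * 2 ^ K)%N by rewrite expnS.
have [||e eu] := @sum_pow2_range K ((2 ^ K.+1).-2 - u)%N; [lia|lia|].
pose f i := (if i < J then d i else e (i - J))%N.
exists (fun i => perturbed_pow2 M (c i) (f i)); first by move=> i; exists (f i).
rewrite big_split_ord /=.
have -> : (\sum_(j < J) perturbed_pow2 M (c j) (f j) = M * u + t)%N.
  rewrite -dt /u big_distrr -big_split /=; apply: eq_bigr => j _.
  by rewrite /perturbed_pow2 /c /f ltn_ord.
have -> : (\sum_(k < K) perturbed_pow2 M (c (J + k)) (f (J + k)) =
           M * ((2 ^ K.+1).-2 - u))%N.
  rewrite -eu big_distrr /=; apply: eq_bigr => k _.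
  by rewrite /perturbed_pow2 /c /f ltnNge leq_addr /= mul0n addn0 addKn.
by rewrite addnAC -mulnDr subnKC//; lia.
Qed.

(** * Choice of the parameters *)

(** The exponent [q] only serves to bound [log2 n] by [b * q]: as [n <= b ^ q] and
    [b < 2 ^ b], one gets [n * 2 ^ b < 2 ^ (b * q.+1)], and [b * q.+1] is still
    [O(n ^ (1 - eps))]. *)
Lemma parameters (R : realType) (eps : R) : 0 < eps < 1 ->
  exists n0 : nat, (0 < n0)%N /\
    forall n : nat, (n0 <= n)%N -> exists b J : nat,
      [/\ (0 < b)%N, (J <= n)%N, (J * 2 ^ b < 2 ^ (n - J))%N &
          n%:R `^ ((1 - eps) ^+ 2 * n%:R) <= (b ^ J)%:R :> R].
Proof.
move=> /andP[e0 e1].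
pose q := (Num.truncn (1 - eps)^-1).+1.
have hq : 1 <= (1 - eps) * q%:R.
  rewrite mulrC -ler_pdivrMr ?subr_gt0// div1r ltW//; exact: truncnS_gt.
(* B is the least value of n ^ eps for which eps * n >= (2 q + 3) n ^ (1 - eps);
   the right-hand side bounds b * q.+1 plus the rounding error in J. *)
pose B : R := (2 * q%:R + 3) / eps.
have B0 : 0 < B by rewrite divr_gt0// ltr_wpDl// mulr_ge0.
exists (Num.truncn (B `^ eps^-1)).+1; split=> // n n0n.
have n_gt0 : (0 < n)%N by apply: leq_trans n0n.
have n1 : 1 <= n%:R :> R by rewrite ler1n.
have nneq0 : n%:R != 0 :> R by rewrite pnatr_eq0 -lt0n.
pose r : R := n%:R `^ (1 - eps).
have r1 : 1 <= r by rewrite -[leLHS](powRr0 n%:R) ler_powR// subr_ge0 ltW.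
have r0 : 0 <= r by apply: le_trans r1.
have en_large : (2 * q%:R + 3) * r <= eps * n%:R.
  have Bn : B <= n%:R `^ eps.
    have -> : B = (B `^ eps^-1) `^ eps.
      by rewrite -powRrM mulVf ?gt_eqF// powRr1// ltW.
    apply: ge0_ler_powR; rewrite ?nnegrE ?powR_ge0 ?ler0n// ltW//.
    by apply: lt_le_trans (truncnS_gt _) _; rewrite ler_nat.
  have -> : n%:R = n%:R `^ eps * r :> R.
    by rewrite /r -powRD ?nneq0 ?implybT// subrKC powRr1// ler0n.
  by rewrite mulrA ler_wpM2r// [leRHS]mulrC -ler_pdivrMr.
pose b := (Num.truncn r).+1; pose J := (Num.truncn ((1 - eps) * n%:R)).+1.
have e1n0 : 0 <= (1 - eps) * n%:R by rewrite mulr_ge0// subr_ge0 ltW.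
have rb : r <= b%:R by apply/ltW/truncnS_gt.
have br : b%:R <= r + 1 by rewrite /b -natr1 lerD2r truncn_le.
have nJ : (1 - eps) * n%:R <= J%:R by apply/ltW/truncnS_gt.
have Jn : J%:R <= (1 - eps) * n%:R + 1 by rewrite /J -natr1 lerD2r truncn_le.
have room : (J + b * q.+1 <= n)%N.
  rewrite -(ler_nat R) natrD natrM -(natr1 q).
  have q0 : 0 <= q%:R :> R by [].
  have : b%:R * (q%:R + 1) <= (r + r) * (q%:R + 1) by rewrite ler_wpM2r//; lra.
  nra.
have nbq : (n <= b ^ q)%N.
  rewrite -(ler_nat R) natrX -[leLHS]powRr1//.
  apply: (le_trans (ler_powR n1 hq)).
  by rewrite powRrM powR_mulrn// lerXn2r// nnegrE.
have bq2 : (b ^ q < 2 ^ (b * q))%N by rewrite expnM ltn_exp2r// ltn_expl.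
exists b, J; split=> //; first by apply: leq_trans room; rewrite leq_addr.
  apply: (@leq_trans (2 ^ (b * q.+1))%N); last by rewrite leq_pexp2l//; lia.
  rewrite mulnS addnC expnD ltn_pmul2r ?expn_gt0//.
  by apply: leq_ltn_trans bq2; apply: leq_trans nbq; lia.
rewrite natrX -(powR_mulrn J)//.
apply: (@le_trans _ _ (r `^ ((1 - eps) * n%:R))).
  by rewrite /r -powRrM mulrA expr2.
apply: (@le_trans _ _ (r `^ J%:R)); first exact: ler_powR.
by apply: ge0_ler_powR; rewrite ?nnegrE.
Qed.

Theorem theorem3p1 :
  exists C : nat,
    forall (R : realType) (eps : R), 0 < eps < 1 ->
      exists n0 : nat, (0 < n0)%N /\
        forall n : nat, (n0 <= n)%N ->
          exists S : 'I_n -> set nat,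
            (forall i, positive_set (S i) /\ log_sparse C (S i)) /\
            exists a d k : nat,
              [/\ (1 <= d)%N,
                  n%:R `^ ((1 - eps) ^+ 2 * n%:R) <= k%:R :> R
                & arith_prog a d k `<=` sumset S].
Proof.
exists 2%N => R eps heps; have [n0 [n0_gt0 H]] := parameters heps.
exists n0; split=> // n /H[b [J [b0 Jn JK len]]].
have [] := interval_in_sumset b0 JK.
rewrite subnKC// => S [SP [a aS]].
by exists S; split=> //; exists a, 1%N, (b ^ J)%N; split.
Qed.
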